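(* Let $m\ge 1$ and $\gamma\in(0,1)$. For each sensor $s=1,\dots,m$ let $\mu_{0s},\mu_{1s}$ be probability measures on $\mathbb{R}^d$ with $\mu_{1s}\ll\mu_{0s}$ and with $\phi_s=d\mu_{1s}/d\mu_{0s}$ nowhere constant, and let $\chi_s(\mathbf{X}_s)=\mu_{0s}\{\mathbf{x}:\phi_s(\mathbf{x})>\phi_s(\mathbf{X}_s)\}$. Let $\hat\chi_s:\mathbb{R}^d\to[0,1]$, $s=1,\dots,m$, be any other measurable transformations such that $\hat\chi_s(\mathbf{X}_s)$ is uniformly distributed on $[0,1]$ when $\mathbf{X}_s\sim\mu_{0s}$. Then, for every configuration of hypotheses $(H^s)_{s=1}^m\in\{H_0,H_1\}^m$, the detection power of the BH procedure at level $\gamma$ applied to the test statistics $\chi_s(\mathbf{X}_s)$, $s=1,\dots,m$, is at least as large as the detection power of the BH procedure at level $\gamma$ applied to the test statistics $\hat\chi_s(\mathbf{X}_s)$, $s=1,\dots,m$.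
   Context: There are $m$ sensors; sensor $s$ has a true hypothesis $H^s\in\{H_0,H_1\}$. Given the configuration of hypotheses, the observations $\mathbf{X}_1,\dots,\mathbf{X}_m$ are independent, with $\mathbf{X}_s\sim\mu_{0s}$ if $H^s=H_0$ and $\mathbf{X}_s\sim\mu_{1s}$ if $H^s=H_1$. ''$\phi_s$ is nowhere constant'' means $\mu_{0s}\{\mathbf{x}:\phi_s(\mathbf{x})=c\}=0$ for every $c$. BH procedure at level $\gamma$: given test statistics $y_1,\dots,y_m\in[0,1]$ with order statistics $y_{(1)}\le\dots\le y_{(m)}$, let $i_{\max}$ be the largest $i$ with $y_{(i)}\le i\gamma/m$; every sensor $s$ with $y_s\le i_{\max}\gamma/m$ is declared $H_1$ and all others are declared $H_0$ (if no such $i$ exists, all sensors are declared $H_0$). The (global) detection power is $1-\Pr\{T\ge 1\}$, where $T$ is the number of missed detections, i.e. of sensors with $H^s=H_1$ that are declared $H_0$; the probability is taken given the configuration of hypotheses. *)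

(* Defs.v *)
From HB Require Import structures.
From mathcomp Require Import all_boot all_order all_algebra.
From mathcomp Require Import all_classical all_reals all_analysis.

Set Implicit Arguments.
Unset Strict Implicit.
Unset Printing Implicit Defensive.

Import Order.TTheory GRing.Theory Num.Theory.
Import numFieldNormedType.Exports.

Local Open Scope classical_set_scope.
Local Open Scope ring_scope.
Local Open Scope charge_scope.

(* R^d is d.-tuple R with the sigma-algebra generated by the coordinate maps,
   that is, the Borel sigma-algebra. *)
Notation euclidean R d := (d.-tuple (measurableTypeR R)).

Section likelihood_ratio.
Context {dE : measure_display} {E : measurableType dE} {R : realType}.
Implicit Types mu : probability E R.

(* phi is a version of the density dmu1/dmu0: the derivative is determined only
   up to a mu0-null set, and the library's 'd _ '/d _ is one chosen version. *)
Definition RN_version mu1 mu0 (phi : E -> R) : Prop :=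
  measurable_fun setT phi /\
  {ae mu0, forall x,
     (phi x)%:E = 'd (charge_of_finite_measure mu1) '/d mu0 x}.

Definition nowhere_constant mu0 (phi : E -> R) : Prop :=
  forall c : R, mu0 [set x | phi x = c] = 0%E.

Definition lr_pvalue mu0 (phi : E -> R) (y : E) : R :=
  fine (mu0 [set x | phi x > phi y]).

Definition uniform_under mu0 (f : E -> R) : Prop :=
  forall A : set (measurableTypeR R), measurable A ->
    mu0 (f @^-1` A) = uniform_prob (@ltr01 R) A.

End likelihood_ratio.

Definition mutually_independent {dO dE : measure_display}
    {Omega : measurableType dO} {E : measurableType dE} {R : realType}
    (P : probability Omega R) (m : nat) (X : 'I_m -> Omega -> E) : Prop :=
  forall (J : {set 'I_m}) (A : 'I_m -> set E),
    (forall s, s \in J -> measurable (A s)) ->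
    P (\bigcap_(s in [set` J]) X s @^-1` A s) =
    (\prod_(s in J) P (X s @^-1` A s))%E.

Section benjamini_hochberg.
Context {R : realType} {m : nat}.
Implicit Types y : 'I_m -> R.

(* y_(i), with i counted from 1 *)
Definition order_stat y (i : nat) : R := nth 0 (sort <=%R (codom y)) i.-1.

(* The value 0 means that no index i in {1, ..., m} qualifies. *)
Definition bh_imax (gamma : R) y : nat :=
  \max_(i < m.+1 | (0 < i)%N && (order_stat y i <= i%:R * gamma / m%:R)) i.

(* true = declared H_1 *)
Definition bh_declare (gamma : R) y (s : 'I_m) : bool :=
  (0 < bh_imax gamma y)%N && (y s <= (bh_imax gamma y)%:R * gamma / m%:R).

(* Configurations H : 'I_m -> bool encode H^s = H_1 as true. *)
Definition bh_missed (gamma : R) (H : 'I_m -> bool) y : nat :=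
  #|[set s | H s && ~~ bh_declare gamma y s]%SET|.

Definition bh_power {dO : measure_display} {Omega : measurableType dO}
    (P : probability Omega R) (gamma : R) (H : 'I_m -> bool)
    (Y : 'I_m -> Omega -> R) : \bar R :=
  (1 - P [set w | (1 <= bh_missed gamma H (fun s => Y s w))%N])%E.

End benjamini_hochberg.

(* Main.v *)
(* The BH procedure only compares the statistics with the m thresholds
   i gamma / m, so its outcome depends on which of m + 1 buckets each statistic
   falls in, and the event "no missed detection" is a lower set of bucket
   vectors. By independence its probability is a finite sum of products, and
   it grows when the law of one coordinate is replaced by a stochastically
   smaller one. That the law of chi_s is stochastically smaller than that of
   hatchi_s under both hypotheses is the Neyman-Pearson lemma: as phi_s is
   nowhere constant, every t in (0, 1) is attained as mu_0s {phi_s > c}, and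
   {phi_s > c} is contained in {chi_s <= t}. *)
Require Import Defs.
From HB Require Import structures.
From mathcomp Require Import all_boot all_order all_algebra.
From mathcomp Require Import all_classical all_reals all_analysis.
From mathcomp Require Import measurable_realfun.

Set Implicit Arguments.
Unset Strict Implicit.
Unset Printing Implicit Defensive.

Import Order.TTheory GRing.Theory Num.Theory.
Import numFieldNormedType.Exports.

Local Open Scope classical_set_scope.
Local Open Scope ring_scope.

(** * The BH decision in terms of thresholds, counts and buckets *)

Section benjamini_hochberg_thresholds.
Context {R : realType} {m : nat}.
Implicit Types (y : 'I_m -> R) (gamma : R).

(** Replaces sorting by counting: in the sorted list the values at most [c] form a prefix, whose
    length is the count. Monotonicity in [y] is visible on the count. *)
Lemma order_stat_le y i c : (0 < i <= m)%N ->
  (order_stat y i <= c) = (i <= #|[set s | (y s <= c)%R]%SET|)%N.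
Proof.
case: i => // i; rewrite /order_stat /= => im.
have sorted_y := sort_sorted (@le_total _ R) (codom y).
have size_y : size (sort <=%R (codom y)) = m.
  by rewrite size_sort size_codom card_ord.
have <- : count (<= c) (sort <=%R (codom y)) = #|[set s | (y s <= c)%R]%SET|.
  rewrite (permP (permEl (perm_sort _ _))) /codom /image_mem count_map.
  rewrite cardsE cardE /enum_mem size_filter count_filter.
  by apply: eq_count => s; rewrite /= !inE andbT.
have [lt_i|le_i] := ltnP i (count (<= c) (sort <=%R (codom y))).
  by rewrite nth_count_le.
by apply/negbTE; rewrite -ltNge nth_count_gt// le_i size_y.
Qed.

(** The maximality in [bh_imax] disappears: thresholds increase with the index, so any qualifying
    index whose threshold bounds [y s] is as good a witness as the largest. Here [i : 'I_m] stands
    for the index [i.+1]. *)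
Lemma bh_declareP gamma y s : 0 < gamma ->
  reflect (exists2 i : 'I_m,
    (i < #|[set s' | (y s' <= i.+1%:R * gamma / m%:R)%R]%SET|)%N &
    y s <= i.+1%:R * gamma / m%:R) (bh_declare gamma y s).
Proof.
move=> gamma_gt0; apply: (iffP andP) => [[]|[i i_card ysi]].
  (* The maximum is either the default 0 of an empty range or attained at a qualifying index. *)
  suff [->//|[i /andP[i_gt0 yi] ->] _] : bh_imax gamma y = 0%N \/
      exists2 i : 'I_m.+1, (0 < i)%N && (order_stat y i <= i%:R * gamma / m%:R) &
      bh_imax gamma y = i.
    case: i i_gt0 yi => -[//|i] i_lt _ yi ysi.
    exists (Ordinal (i_lt : (i < m)%N)) => //=.
    by rewrite order_stat_le in yi.
  rewrite /bh_imax.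
  elim/big_ind: _ => [|a b IHa IHb|i Pi]; [by left| |by right; exists i].
  by rewrite /maxn; case: ifP.
have i_max : (i.+1 <= bh_imax gamma y)%N.
  apply: (@leq_bigmax_cond 'I_m.+1 _ (@nat_of_ord _) (lift ord0 i)).
  by rewrite lift0 /= order_stat_le// ltn_ord.
split; first exact: leq_ltn_trans i_max.
apply: le_trans ysi _.
have m_gt0 : (0 < m)%N by exact: leq_ltn_trans (ltn_ord i).
by rewrite ler_pM2r ?invr_gt0 ?ltr0n// ler_pM2r// ler_nat.
Qed.

(** In [bh_declareP] both the count and the comparison for [s] can only improve. Assuming the
    implication at the thresholds alone, instead of [y' s <= y s], lets statistics be exchanged for
    bucket representatives. *)
Lemma bh_declare_mono gamma y y' s : 0 < gamma ->
  (forall s (i : 'I_m), y s <= i.+1%:R * gamma / m%:R ->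
                        y' s <= i.+1%:R * gamma / m%:R) ->
  bh_declare gamma y s -> bh_declare gamma y' s.
Proof.
move=> gamma_gt0 yy' /bh_declareP-/(_ gamma_gt0)[i i_card ysi].
apply/bh_declareP => //; exists i; last exact: yy'.
apply: leq_trans i_card _; apply/subset_leq_card/fintype.subsetP => s'.
by rewrite !inE; exact: yy'.
Qed.

Lemma bh_missed0_mono gamma H y y' : 0 < gamma ->
  (forall s (i : 'I_m), y s <= i.+1%:R * gamma / m%:R ->
                        y' s <= i.+1%:R * gamma / m%:R) ->
  bh_missed gamma H y = 0%N -> bh_missed gamma H y' = 0%N.
Proof.
move=> gamma_gt0 yy' /eqP; rewrite cards_eq0 => /eqP y0; apply/eqP.
rewrite cards_eq0 -finset.subset0 -y0; apply/fintype.subsetP => s; rewrite !inE.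
case: (H s) => //=; apply: contra; exact: bh_declare_mono.
Qed.

(* 0-based index of the first threshold (i + 1) gamma / m reached by x, and m
   when there is none. *)
Definition bucket gamma (x : R) : 'I_m.+1 :=
  inord (find (fun i => x <= i.+1%:R * gamma / m%:R) (iota 0 m)).

(** Thresholds are nondecreasing in the index, so once one is reached all later ones are. *)
Lemma bucket_le gamma x (i : nat) : 0 <= gamma -> (i < m)%N ->
  (bucket gamma x <= i)%N = (x <= i.+1%:R * gamma / m%:R).
Proof.
move=> gamma_ge0 im.
set a := fun i : nat => x <= i.+1%:R * gamma / m%:R.
have bE : bucket gamma x = find a (iota 0 m) :> nat.
  by rewrite inordK// ltnS -[leqRHS](size_iota 0 m) find_size.
rewrite bE; apply/idP/idP => [fi|xi].
  have fm : (find a (iota 0 m) < m)%N by exact: leq_ltn_trans im.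
  have : a (nth 0%N (iota 0 m) (find a (iota 0 m))).
    by apply: nth_find; rewrite has_find size_iota.
  rewrite nth_iota// add0n /a => /le_trans; apply.
  by rewrite ler_wpM2r// ler_wpM2r// ler_nat ltnS.
rewrite leqNgt; apply/negP => /(before_find 0%N).
by rewrite nth_iota// add0n /a xi.
Qed.

(** A representative of bucket [j]: the threshold itself for [j < m], and for [j = m] a value above
    all thresholds when [gamma] is positive. *)
Definition bucket_top gamma (j : 'I_m.+1) : R := j.+1%:R * gamma / m%:R.

Lemma bucket_top_le gamma (j : 'I_m.+1) (i : 'I_m) : 0 < gamma ->
  (bucket_top gamma j <= i.+1%:R * gamma / m%:R) = (j <= i)%N.
Proof.
move=> gamma_gt0; have m_gt0 : (0 < m)%N by apply: leq_ltn_trans (ltn_ord i).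
by rewrite /bucket_top ler_pM2r ?invr_gt0 ?ltr0n// ler_pM2r// ler_nat ltnS.
Qed.

Definition all_detected gamma (H : 'I_m -> bool) (b : {ffun 'I_m -> 'I_m.+1}) :=
  bh_missed gamma H (fun s => bucket_top gamma (b s)) == 0%N.

(** Each [y s] lies below exactly the same thresholds as the representative of its bucket, so
    [bh_missed0_mono] applies in both directions. *)
Lemma all_detected_bucket gamma H y : 0 < gamma ->
  (bh_missed gamma H y == 0%N) =
  all_detected gamma H [ffun s => bucket gamma (y s)].
Proof.
move=> gamma_gt0; apply/idP/idP => /eqP H0; apply/eqP; move: H0;
  apply: bh_missed0_mono => // s i;
  by rewrite ffunE bucket_top_le// bucket_le// ltW.
Qed.

Lemma all_detected_lower gamma H (b b' : {ffun 'I_m -> 'I_m.+1}) : 0 < gamma ->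
  (forall s, (b' s <= b s)%N) ->
  all_detected gamma H b -> all_detected gamma H b'.
Proof.
move=> gamma_gt0 bb' /eqP b0; apply/eqP; move: b0.
apply: bh_missed0_mono => // s i; rewrite !bucket_top_le//.
exact: leq_trans.
Qed.

End benjamini_hochberg_thresholds.

(** * Stochastic dominance for product weights on a finite grid *)

Section finite_stochastic_dominance.
Context {R : realDomainType}.

(** A lower set of ['I_k] is empty or an initial segment, and initial segments are covered by
    hypothesis. *)
Lemma le_sum_lower_set (k : nat) (f : pred 'I_k) (p q : 'I_k -> R) :
  (forall i j : 'I_k, (i <= j)%N -> f j -> f i) ->
  (forall t : 'I_k, \sum_(j < k | (j <= t)%N) q j <=
                   \sum_(j < k | (j <= t)%N) p j) ->
  \sum_(j | f j) q j <= \sum_(j | f j) p j.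
Proof.
move=> f_lower pq; case: (pickP f) => [j0 fj0|f0]; last first.
  by rewrite !big_pred0.
have [t ft tmax] := arg_maxnP (@nat_of_ord k) fj0.
have fE j : f j = (j <= t)%N.
  by apply/idP/idP => [/tmax|/f_lower]; [|exact].
by rewrite !(eq_bigl _ _ fE).
Qed.

Variables (I : finType) (k : nat).
Implicit Types b : {ffun I -> 'I_k}.

Let upd b n j : {ffun I -> 'I_k} := [ffun s => if s == n then j else b s].

(* The map (b, j) |-> (b[n := j], b n) is an involution, which frees the n-th
   coordinate; the factor k counts the dummy value. *)
Let free_coordinate (F : pred {ffun I -> 'I_k}) (r : I -> 'I_k -> R) (n : I) :
  k%:R * \sum_(b : {ffun I -> 'I_k} | F b) \prod_s r s (b s) =
  \sum_(b : {ffun I -> 'I_k}) (\prod_(s | s != n) r s (b s)) *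
                            \sum_(j | F (upd b n j)) r n j.
Proof.
rewrite mulr_natl.
transitivity (\sum_(b : {ffun I -> 'I_k}) \sum_(j < k)
   (if F (upd b n j) then r n j * \prod_(s | s != n) r s (b s) else 0)).
  rewrite pair_bigA /=.
  pose h (u : {ffun I -> 'I_k} * 'I_k) := (upd u.1 n u.2, u.1 n).
  have hK : involutive h.
    move=> [b j]; rewrite /h /= ffunE eqxx; congr (_, _).
    by apply/ffunP => s; rewrite !ffunE; case: eqP => [->|].
  rewrite (reindex_inj (inv_inj hK)) /=.
  rewrite -(pair_bigA _ (fun b j => if F (upd (upd b n j) n (b n)) then
     r n (b n) * \prod_(s | s != n) r s (upd b n j s) else 0)) /=.
  rewrite [in LHS]big_mkcond /= -sumrMnl; apply: eq_bigr => b _.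
  transitivity (\sum_(j < k) (if F b then \prod_s r s (b s) else 0)).
    by rewrite sumr_const card_ord.
  apply: eq_bigr => j _.
  have -> : upd (upd b n j) n (b n) = b.
    by apply/ffunP => s; rewrite !ffunE; case: eqP => [->|].
  case: ifP => // _; rewrite (bigD1 n)//=.
  rewrite [in RHS](eq_bigr (fun s => r s (b s)))// => s /negbTE sn.
  by rewrite ffunE sn.
apply: eq_bigr => b _; rewrite mulr_sumr [in RHS]big_mkcond.
by apply: eq_bigr => j _; case: ifP => _; rewrite ?mulr0// mulrC.
Qed.

(** After [free_coordinate], the two sides differ only in the inner sums over the slices of [F] in
    direction [n]. These slices are lower sets, and the common outer factors are nonnegative. *)
Let dominance_coordinate (F : pred {ffun I -> 'I_k}) (p q : I -> 'I_k -> R) n :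
  (forall b b', (forall s, (b' s <= b s)%N) -> F b -> F b') ->
  (forall s j, 0 <= q s j) ->
  (forall s, s != n -> p s = q s) ->
  (forall t : 'I_k, \sum_(j < k | (j <= t)%N) q n j <=
                   \sum_(j < k | (j <= t)%N) p n j) ->
  \sum_(b : {ffun I -> 'I_k} | F b) \prod_s q s (b s) <=
  \sum_(b : {ffun I -> 'I_k} | F b) \prod_s p s (b s).
Proof.
(* The factor [k] of [free_coordinate] can be cancelled only if it is nonzero; for [k = 0] no [b]
   exists, since [b n] would lie in ['I_0]. *)
move=> F_lower q0 pq pqn; have [k0|k_gt0] := posnP k.
  rewrite !big1// => b _;
    by have := leq_trans (ltn_ord (b n)) (eq_leq k0).
rewrite -(@ler_pM2l _ k%:R) ?ltr0n// !(free_coordinate F _ n).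
apply: ler_sum => b _.
under [in leRHS]eq_bigr => s sn do rewrite pq//.
apply: ler_wpM2l; first exact: prodr_ge0.
apply: le_sum_lower_set => // i j ij; apply: F_lower => s.
by rewrite !ffunE; case: eqP.
Qed.

Lemma product_dominance (F : pred {ffun I -> 'I_k}) (p q : I -> 'I_k -> R) :
  (forall b b', (forall s, (b' s <= b s)%N) -> F b -> F b') ->
  (forall s j, 0 <= p s j) -> (forall s j, 0 <= q s j) ->
  (forall s (t : 'I_k),
    \sum_(j < k | (j <= t)%N) q s j <= \sum_(j < k | (j <= t)%N) p s j) ->
  \sum_(b : {ffun I -> 'I_k} | F b) \prod_s q s (b s) <=
  \sum_(b : {ffun I -> 'I_k} | F b) \prod_s p s (b s).
Proof.
move=> F_lower p0 q0 pq.
(* Hybrid argument: [r l] uses [p] on the coordinates in [l] and [q] elsewhere, and [l] grows from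
   the empty list to [enum I], one coordinate at a time. *)
pose r (l : seq I) s := if s \in l then p s else q s.
suff H l : \sum_(b : {ffun I -> 'I_k} | F b) \prod_s q s (b s) <=
           \sum_(b : {ffun I -> 'I_k} | F b) \prod_s r l s (b s).
  apply: (le_trans (H (enum I))); rewrite le_eqVlt; apply/orP; left; apply/eqP.
  by apply: eq_bigr => b _; apply: eq_bigr => s _; rewrite /r mem_enum.
elim: l => [|n l IH]; first exact: lexx.
apply: (le_trans IH); apply: (@dominance_coordinate _ _ _ n) => //.
- by move=> s j; rewrite /r; case: ifP.
- by move=> s /negbTE sn; rewrite /r inE sn.
- by move=> t; rewrite /r mem_head; case: ifP.
Qed.

End finite_stochastic_dominance.

(** * Events determined by a finite-valued map *)

Section finite_valued.
Context {d : measure_display} {E : measurableType d} {R : realType}.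
Variables (T : finType) (g : E -> T).
Hypothesis mg : forall j, measurable (g @^-1` [set j]).

Let finite_valuedE (B : pred T) :
  [set x | B (g x)] = \bigcup_(j in [set j | B j]) g @^-1` [set j].
Proof.
apply/seteqP; split => x /=; first by move=> Bx; exists (g x).
by move=> [j /= Bj ->].
Qed.

Lemma measurable_finite_valued (B : pred T) : measurable [set x | B (g x)].
Proof. by rewrite finite_valuedE; exact: fin_bigcup_measurable. Qed.

Lemma probability_finite_valued (P : probability E R) (B : pred T) :
  (P [set x | B (g x)] = \sum_(j | B j) P (g @^-1` [set j]))%E.
Proof.
rewrite finite_valuedE; pose r := [seq j <- index_enum T | B j].
have -> : [set j | B j] = [set` r].
  by apply/seteqP; split => j; rewrite /= mem_filter mem_index_enum andbT.
rewrite measure_fin_bigcup//; last by move=> i j _ _ [x [<- <-]].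
by rewrite -fsbig_seq ?filter_uniq ?index_enum_uniq// big_filter.
Qed.

Lemma sum_fine_finite_valued (P : probability E R) (B : pred T) :
  \sum_(j | B j) fine (P (g @^-1` [set j])) = fine (P [set x | B (g x)]).
Proof.
rewrite probability_finite_valued -[LHS]/(fine (_)%:E) -sumEFin; congr fine.
by apply: eq_bigr => j _; rewrite fineK// fin_num_measure.
Qed.

End finite_valued.

(** * The joint law of discretized independent observations *)

Section joint_law.
Context {dO dE : measure_display} {Omega : measurableType dO}
  {E : measurableType dE} {R : realType} (P : probability Omega R).
Variables (m k : nat) (X : 'I_m -> {RV P >-> E}) (g : 'I_m -> E -> 'I_k).
Hypothesis indepX : mutually_independent P (fun s => X s : Omega -> E).
Hypothesis mg : forall s j, measurable (g s @^-1` [set j]).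

Let cell (b : {ffun 'I_m -> 'I_k}) := [set w | [ffun s => g s (X s w)] = b].

Let cellE b : cell b =
  \bigcap_(s in [set` [set: 'I_m]%SET]) X s @^-1` (g s @^-1` [set b s]).
Proof.
apply/seteqP; split => w /=.
  by move=> /ffunP gX s _ /=; rewrite -gX ffunE.
by move=> gX; apply/ffunP => s; rewrite ffunE; apply: gX; rewrite /= inE.
Qed.

Let measurable_cell b : measurable (cell b).
Proof.
rewrite cellE; apply: fin_bigcap_measurable => // s _.
exact: measurable_funPTI.
Qed.

Lemma measurable_discretized_event (B : pred {ffun 'I_m -> 'I_k}) :
  measurable [set w | B [ffun s => g s (X s w)]].
Proof. exact: measurable_finite_valued. Qed.

(** The event splits into disjoint cells, one per value vector; each cell is an intersection over
    all sensors, so independence factors its probability. *)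
Lemma probability_discretized_event (B : pred {ffun 'I_m -> 'I_k}) :
  P [set w | B [ffun s => g s (X s w)]] =
  (\sum_(b : {ffun 'I_m -> 'I_k} | B b)
     \prod_s fine (distribution P (X s) (g s @^-1` [set b s])))%:E.
Proof.
rewrite (probability_finite_valued measurable_cell) -sumEFin.
apply: eq_bigr => b _.
rewrite -[X in P X = _]/(cell b) cellE; transitivity (\prod_(s in [set: 'I_m]%SET)
    P (X s @^-1` (g s @^-1` [set b s])))%E; first exact: indepX.
rewrite -prodEFin; apply: eq_big => [s|s _]; first by rewrite inE.
by rewrite fineK// fin_num_measure.
Qed.

End joint_law.

(** * Likelihood ratio tests and the Neyman-Pearson lemma *)

Section likelihood_ratio_test.
Context {dE : measure_display} {E : measurableType dE} {R : realType}.
Implicit Types (mu : probability E R) (phi : E -> R).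

Lemma measurable_gtr phi (c : R) : measurable_fun setT phi ->
  measurable [set x | phi x > c].
Proof.
move=> mphi; rewrite (_ : [set _ | _] = phi @^-1` `]c, +oo[).
  by rewrite -[X in measurable X]setTI; exact: mphi.
by apply/seteqP; split => x /=; rewrite in_itv/= andbT.
Qed.

Lemma measurable_ler phi (c : R) : measurable_fun setT phi ->
  measurable [set x | phi x <= c].
Proof.
move=> mphi; rewrite (_ : [set _ | _] = phi @^-1` `]-oo, c]).
  by rewrite -[X in measurable X]setTI; exact: mphi.
by apply/seteqP; split => x /=; rewrite in_itv.
Qed.

Lemma uniform_under_le mu f (t : R) : 0 < t < 1 -> uniform_under mu f ->
  mu [set x | f x <= t] = t%:E.
Proof.
move=> /andP[t_gt0 t_lt1] fU.
rewrite (_ : [set _ | _] = f @^-1` `]-oo, t]); last first.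
  by apply/seteqP; split => x /=; rewrite in_itv.
rewrite fU// /uniform_prob integral_uniform_pdf.
rewrite (_ : _ `&` _ = `[0, t]%classic); last first.
  apply/seteqP; split => x /=; rewrite !in_itv/=.
    by move=> [-> /andP[-> _]].
  by move=> /andP[-> xt]; rewrite xt (le_trans xt (ltW t_lt1)).
rewrite (eq_integral (cst 1%E)); last first.
  move=> x; rewrite inE/= in_itv/= /uniform_pdf => /andP[-> xt].
  by rewrite (le_trans xt (ltW t_lt1)) subr0 invr1.
by rewrite integral_cst//= mul1e lebesgue_measure_itv/= lte_fin t_gt0 sube0.
Qed.

(** An intermediate value argument for the survival function [G] of [phi]: it decreases from 1 to 0
    and is right-continuous, and the absence of atoms supplies left-continuity. The witness is the
    supremum of the [r] with [G r >= t]. *)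
Lemma nowhere_constant_level mu phi (t : R) : measurable_fun setT phi ->
  nowhere_constant mu phi -> 0 < t < 1 ->
  exists c, mu [set x | phi x > c] = t%:E.
Proof.
move=> mphi phi_nc /andP[t_gt0 t_lt1].
pose Y : {mfun E >-> R} := mfun_Sub (mem_set mphi).
have YE c : ccdf (Y : {RV mu >-> R}) c = mu [set x | phi x > c].
  rewrite /ccdf /distribution /pushforward; congr (mu _).
  by apply/seteqP; split => x /=; rewrite in_itv/= andbT.
pose G := ccdf (Y : {RV mu >-> R}).
have G_ni r s : r <= s -> (G s <= G r)%E by exact: ccdf_nonincreasing.
pose S := [set r | (t%:E <= G r)%E].
have [r0 Sr0] : S !=set0.
  apply: contrapT => S0; have : (1 <= t%:E)%E.
    apply: cvge_le (@cvg_ccdfNy1 _ _ _ mu Y); apply: nearW => r.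
    by rewrite leNgt; apply/negP => /ltW Gr; apply: S0; exists r.
  by rewrite lee_fin leNgt t_lt1.
have [r1 Sr1] : exists r1, (G r1 < t%:E)%E.
  apply: contrapT => S0; have : (t%:E <= 0)%E.
    apply: cvge_ge (@cvg_ccdfy0 _ _ _ mu Y); apply: nearW => r.
    by rewrite leNgt; apply/negP => Gr; apply: S0; exists r.
  by rewrite lee_fin leNgt t_gt0.
have supS : has_sup S.
  split; first by exists r0.
  exists r1 => r /= Sr; rewrite leNgt; apply/negP => /ltW/G_ni /(le_trans Sr).
  by rewrite leNgt Sr1.
exists (sup S); rewrite -YE -/G; apply/eqP; rewrite eq_le; apply/andP; split.
  (* Points to the right of [sup S] are outside [S], so [G] is below [t] there, and right-continuity
     gives [G (sup S) <= t]. *)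
  have := @ccdf_right_continuous _ _ _ mu Y (sup S).
  apply: cvge_le; near=> r.
  rewrite leNgt; apply/negP => /ltW /(ub_le_sup supS.2).
  apply/negP; rewrite -ltNge; near: r; exact: nbhs_right_gt.
(* The sets [F n] decrease to the set where [phi x >= sup S], which exceeds that of [phi x > sup S]
   by a null set. Each has measure at least [t], because some element of [S] lies above
   [sup S - n.+1%:R^-1]. *)
pose F n := [set x | phi x > sup S - n.+1%:R^-1].
have mF n : measurable (F n) by exact: measurable_gtr.
have -> : G (sup S) = mu (\bigcap_n F n).
  have -> : \bigcap_n F n = [set x | phi x > sup S] `|` [set x | phi x = sup S].
    apply/seteqP; split => x /=.
      move=> Fx; case: (ltgtP (phi x) (sup S)) => [xS| |]; [|by left|by right].
      have [n] := ltr_add_invr xS.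
      have := Fx n Logic.I; rewrite /F /= ltrBlDr => /lt_trans /[apply].
      by rewrite ltxx.
    move=> [Sx|Sx] n _; rewrite /F /= ltrBlDr; last by rewrite Sx ltrDl.
    by rewrite (lt_trans Sx)// ltrDl.
  rewrite /G YE measureU0//; first exact: measurable_gtr.
    by rewrite -[X in measurable X]setTI; apply: (mphi measurableT [set sup S]).
  exact: phi_nc.
have : (mu \o F) n @[n --> \oo] --> mu (\bigcap_n F n).
  apply: nonincreasing_cvg_mu => //.
  - by rewrite (le_lt_trans (probability_le1 mu (mF 0%N)))// ltry.
  - exact: bigcap_measurable.
  - apply/nonincreasing_seqP => n; apply/subsetPset => x; rewrite /F /=.
    by apply: le_lt_trans; rewrite lerB// lef_pV2 ?posrE// ler_nat.
apply: cvge_ge; near=> n; rewrite /= /F -YE.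
have [r Sr ltr] : exists2 r, S r & sup S - n.+1%:R^-1 < r.
  by apply: sup_adherent => //; rewrite invr_gt0.
by apply: (le_trans Sr); rewrite G_ni// ltW.
Unshelve. all: by end_near.
Qed.

(** Outside their common part, [A] and the likelihood ratio region [S] have equal [mu0]-mass, while
    the density is at most [c] on [A] minus [S] and above [c] on [S] minus [A]. *)
Lemma neyman_pearson (mu0 mu1 : probability E R) phi (c : R) (A : set E) :
  mu1 `<< mu0 -> RN_version mu1 mu0 phi -> measurable A ->
  mu0 A = mu0 [set x | (phi x > c)%R] ->
  (mu1 A <= mu1 [set x | (phi x > c)%R])%E.
Proof.
move=> mu10 [mphi phiE] mA mu0A.
set S := [set x | phi x > c] in mu0A *.
have mS : measurable S by exact: measurable_gtr.
have mRN := Radon_Nikodym_integrable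
  (mu10 : charge_of_finite_measure mu1 `<< mu0).
(* Integrability passes from the chosen Radon-Nikodym derivative to [phi] by almost everywhere
   equality. *)
have iphi : mu0.-integrable setT (EFin \o phi).
  have /measurable_EFinP mEphi := mphi.
  have /integrableP[mh hfin] := mRN.
  apply/integrableP; split => //; apply: le_lt_trans hfin.
  rewrite le_eqVlt; apply/orP; left; apply/eqP; apply: ae_eq_integral => //.
  - exact: measurableT_comp.
  - exact: measurableT_comp.
  - by apply: filterS phiE => x phix _; congr abse; exact: phix.
have mu1E B : measurable B -> mu1 B = (\int[mu0]_(x in B) (phi x)%:E)%E.
  move=> mB; rewrite -[LHS]/(charge_of_finite_measure mu1 B).
  rewrite (@Radon_Nikodym_integral _ _ _ _ mu0)//.
  apply: ae_eq_integral => //.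
  - exact: (measurable_int mu0 (integrableS measurableT mB (@subsetT _ _) mRN)).
  - exact: (measurable_int mu0 (integrableS measurableT mB (@subsetT _ _) iphi)).
  - by apply: filterS phiE => x phix _; exact: esym phix.
have cst_int B : measurable B -> (\int[mu0]_(x in B) c%:E = c%:E * mu0 B)%E.
  by move=> mB; rewrite integral_cst.
have i_cst B : measurable B -> mu0.-integrable B (cst c%:E).
  by move=> mB; apply: finite_measure_integrable_cst.
have mAS := measurableD mA mS; have mSA := measurableD mS mA.
have splitE (mu : probability E R) B C : measurable B -> measurable C ->
    mu B = (mu (B `\` C) + mu (B `&` C))%E by exact: measureDI.
have diff_eq : mu0 (A `\` S) = mu0 (S `\` A).
  rewrite -[LHS](@addeK _ (mu0 (A `&` S)))//; last first.
    by rewrite fin_num_measure//; exact: measurableI.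
  rewrite -splitE// mu0A (splitE mu0 _ _ mS mA) setIC addeK//.
  by rewrite fin_num_measure//; exact: measurableI.
rewrite (splitE mu1 _ _ mA mS) (splitE mu1 _ _ mS mA) setIC leeD2r//.
(* The pivot is [c] times the common [mu0]-mass of the two differences. *)
apply: (@le_trans _ _ (c%:E * mu0 (A `\` S))%E).
  rewrite mu1E// -cst_int//; apply: le_integral => //; last first.
  - by move=> x; rewrite inE => -[_ /negP]; rewrite -leNgt lee_fin.
  - exact: i_cst.
  - exact: (integrableS measurableT mAS (@subsetT _ _) iphi).
rewrite diff_eq mu1E// -cst_int//; apply: le_integral => //; last first.
- by move=> x; rewrite inE => -[/ltW + _]; rewrite lee_fin.
- exact: (integrableS measurableT mSA (@subsetT _ _) iphi).
- exact: i_cst.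
Qed.

(** The p-value is the nonincreasing survival function of [phi] evaluated at [phi]. *)
Lemma measurable_lr_pvalue mu phi : measurable_fun setT phi ->
  measurable_fun setT (lr_pvalue mu phi).
Proof.
move=> mphi.
pose G (c : R) : R := fine (mu [set x | phi x > c]).
rewrite -[lr_pvalue mu phi]/(G \o phi); apply: measurableT_comp => //.
apply: nonincreasing_measurable => // r s rs; rewrite fine_le//.
- by rewrite fin_num_measure//; exact: measurable_gtr.
- by rewrite fin_num_measure//; exact: measurable_gtr.
- by apply: le_measure; rewrite ?inE; [exact: measurable_gtr..|];
    move=> x; exact: le_lt_trans.
Qed.

(** Both inequalities pass through the region [phi x > c] of [mu0]-mass [t]: uniformity gives the
    region [f x <= t] the same [mu0]-mass, so [neyman_pearson] compares the two under [mu1]. *)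
Lemma lr_pvalue_dominates (mu0 mu1 : probability E R) phi f (t : R) :
  mu1 `<< mu0 -> RN_version mu1 mu0 phi -> nowhere_constant mu0 phi ->
  measurable_fun setT f -> uniform_under mu0 f -> 0 < t < 1 ->
  (mu0 [set x | (f x <= t)%R] <= mu0 [set x | (lr_pvalue mu0 phi x <= t)%R])%E /\
  (mu1 [set x | (f x <= t)%R] <= mu1 [set x | (lr_pvalue mu0 phi x <= t)%R])%E.
Proof.
move=> mu10 phi_RN phi_nc mf fU t01; have [mphi _] := phi_RN.
have [c muc] := nowhere_constant_level mphi phi_nc t01.
have mS := measurable_gtr c mphi.
have mL := measurable_ler t (measurable_lr_pvalue mu0 mphi).
(* If [phi x > c], the superlevel set defining the p-value at [x] lies inside the one of mass
   [t]. *)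
have SL : [set x | phi x > c] `<=` [set x | lr_pvalue mu0 phi x <= t].
  move=> x /= cx; rewrite /lr_pvalue -lee_fin fineK; last first.
    by rewrite fin_num_measure//; exact: measurable_gtr.
  rewrite -muc; apply: le_measure; rewrite ?inE//; first exact: measurable_gtr.
  by move=> z; exact: lt_trans.
have ft := uniform_under_le t01 fU.
split.
  by rewrite ft -muc; apply: le_measure; rewrite ?inE.
apply: (@le_trans _ _ (mu1 [set x | phi x > c])); last first.
  by apply: le_measure; rewrite ?inE.
apply: (neyman_pearson mu10 phi_RN); first exact: measurable_ler.
by rewrite ft -muc.
Qed.

End likelihood_ratio_test.

(** * BH power as a finite sum over bucket vectors *)

Section bh_power_buckets.
Context {dE : measure_display} {E : measurableType dE} {R : realType} {m : nat}.
Variable gamma : R.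
Hypothesis gamma_gt0 : 0 < gamma.

Lemma bucket_le_preimage (f : E -> R) (i : 'I_m.+1) :
  [set x | ((bucket gamma (f x) : 'I_m.+1) <= i)%N] =
  if (i < m)%N then [set x | f x <= i.+1%:R * gamma / m%:R] else setT.
Proof.
case: ltnP => im; apply/seteqP; split => x //=.
- by rewrite bucket_le// ltW.
- by rewrite bucket_le// ltW.
- by move=> _; exact: leq_trans (leq_ord _) im.
Qed.

Lemma measurable_bucket (f : E -> R) (j : 'I_m.+1) : measurable_fun setT f ->
  measurable ((fun x => bucket gamma (f x)) @^-1` [set j]).
Proof.
move=> mf.
have mle (i : 'I_m.+1) :
    measurable [set x | ((bucket gamma (f x) : 'I_m.+1) <= i)%N].
  by rewrite bucket_le_preimage; case: ifP => // _; exact: measurable_ler.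
(* A fibre is a sublevel set minus the strictly lower ones, which are preimages of half-lines or
   everything. *)
rewrite (_ : _ @^-1` _ = [set x | ((bucket gamma (f x) : 'I_m.+1) <= j)%N] `\`
    \bigcup_(i in [set i : 'I_m.+1 | (i < j)%N])
      [set x | ((bucket gamma (f x) : 'I_m.+1) <= i)%N]).
  by apply: measurableD => //; exact: fin_bigcup_measurable.
apply/seteqP; split => x /=.
  move=> xj; split; [by rewrite xj|move=> [i /= ij]; rewrite xj => ji].
  by have := leq_trans ij ji; rewrite ltnn.
move=> [xj xNj]; apply/val_inj/eqP; rewrite eqn_leq xj /= leqNgt.
by apply/negP => xj'; apply: xNj; exists (bucket gamma (f x)) => /=.
Qed.

Lemma bh_powerE {dO : measure_display} {Omega : measurableType dO}
    (P : probability Omega R) (H : 'I_m -> bool)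
    (X : 'I_m -> {RV P >-> E}) (f : 'I_m -> E -> R) :
  mutually_independent P (fun s => X s : Omega -> E) ->
  (forall s, measurable_fun setT (f s)) ->
  bh_power P gamma H (fun s w => f s (X s w)) =
  (\sum_(b : {ffun 'I_m -> 'I_m.+1} | all_detected gamma H b)
    \prod_s fine (distribution P (X s)
      ((fun x => bucket gamma (f s x)) @^-1` [set b s])))%:E.
Proof.
move=> indepX mf.
have mg s j := measurable_bucket j (mf s).
rewrite -(probability_discretized_event indepX mg) /bh_power.
have mB := measurable_discretized_event X mg (all_detected gamma H).
(* A double complement brings the probability of full detection into the form [1 - P _] of
   [bh_power]. *)
rewrite -[in RHS](setCK [set w | _]) probability_setC; last exact: measurableC.
congr (1 - P _)%E; apply/seteqP; split => w /=.
  by move=> missed; apply/negP; rewrite -all_detected_bucket// -lt0n.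
by move=> /negP; rewrite -all_detected_bucket// -lt0n.
Qed.

End bh_power_buckets.

(** * Comparison of the two detection powers *)

Theorem corollary4p6 (R : realType) (m d : nat) (gamma : R)
  (mu0 mu1 : 'I_m -> probability (euclidean R d) R)
  (phi : 'I_m -> euclidean R d -> R)
  (hatchi : 'I_m -> euclidean R d -> R) :
  (1 <= m)%N ->
  0 < gamma < 1 ->
  (forall s, mu1 s `<< mu0 s) ->
  (forall s, RN_version (mu1 s) (mu0 s) (phi s)) ->
  (forall s, nowhere_constant (mu0 s) (phi s)) ->
  (forall s, measurable_fun setT (hatchi s)) ->
  (forall s x, 0 <= hatchi s x <= 1) ->
  (forall s, uniform_under (mu0 s) (hatchi s)) ->
  forall (H : 'I_m -> bool)
    (dO : measure_display) (Omega : measurableType dO)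
    (P : probability Omega R) (X : 'I_m -> {RV P >-> euclidean R d}),
  mutually_independent P (fun s => X s : Omega -> euclidean R d) ->
  (forall s (A : set (euclidean R d)), measurable A ->
     distribution P (X s) A = (if H s then mu1 s else mu0 s) A) ->
  (bh_power P gamma H (fun s w => hatchi s (X s w)) <=
   bh_power P gamma H (fun s w => lr_pvalue (mu0 s) (phi s) (X s w)))%E.
Proof.
move=> m_gt0 /andP[gamma_gt0 gamma_lt1] mu10 phi_RN phi_nc mhat hat01 hatU.
move=> H dO Omega P X indepX lawX.
have mlr s := measurable_lr_pvalue (mu0 s) (phi_RN s).1.
rewrite (bh_powerE gamma_gt0 H indepX mhat) (bh_powerE gamma_gt0 H indepX mlr).
pose pr (f : 'I_m -> euclidean R d -> R) s (j : 'I_m.+1) : R :=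
  fine (distribution P (X s) ((fun x => bucket gamma (f s x)) @^-1` [set j])).
rewrite lee_fin; apply: (@product_dominance R 'I_m m.+1 _
  (pr (fun s => lr_pvalue (mu0 s) (phi s))) (pr hatchi)).
- by move=> b b'; exact: all_detected_lower.
- by move=> s j; exact: fine_ge0.
- by move=> s j; exact: fine_ge0.
(* What remains is dominance for one sensor: the partial sums up to bucket [t] are the probabilities
   that the statistic reaches the threshold of index [t.+1]. *)
move=> s t.
rewrite (sum_fine_finite_valued
  (fun j => measurable_bucket gamma_gt0 j (mhat s)) _
  (fun j => (j <= t)%N)).
rewrite (sum_fine_finite_valued
  (fun j => measurable_bucket gamma_gt0 j (mlr s)) _
  (fun j => (j <= t)%N)).
(* For [t = m] both sides are the total mass. *)
rewrite !bucket_le_preimage//; case: ifP => // tm.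
set c := t.+1%:R * gamma / m%:R.
(* Since [t.+1 <= m] and [gamma < 1], the threshold stays strictly below 1. *)
have c01 : 0 < c < 1.
  rewrite divr_gt0 ?mulr_gt0 ?ltr0n//= ltr_pdivrMr ?ltr0n// mul1r.
  by rewrite (@lt_le_trans _ _ t.+1%:R) ?ler_nat// gtr_pMr ?ltr0n.
have mhat_le := measurable_ler c (mhat s).
have mlr_le := measurable_ler c (mlr s).
have [dom0 dom1] := lr_pvalue_dominates (mu10 s) (phi_RN s) (phi_nc s) (mhat s)
  (hatU s) c01.
rewrite fine_le ?fin_num_measure//.
change (distribution P (X s) [set x | (hatchi s x <= c)%R] <=
        distribution P (X s) [set x | (lr_pvalue (mu0 s) (phi s) x <= c)%R])%E.
by rewrite !lawX//; case: (H s).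
Qed.
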